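(* For every $t\ge 0$, every $k\ge 1$ and every collection $\Omega$ of functions: (1) $\rho_0\bigl(\mathsf{gcr}^{(t)}\bigr)=\rho_0\bigl(\mathsf{TL}_2^{(t+1)}(\Omega)\bigr)=\rho_0\bigl(\mathsf{gwl}_1^{(t)}\bigr)$; (2) $\rho_0\bigl(\mathsf{gwl}_k^{(\infty)}\bigr)=\rho_0\bigl(\mathsf{TL}_{k+1}(\Omega)\bigr)$.
   Context: Fix integers $n\ge 1$ and $\ell\ge 1$. A graph is a triple $G=(V_G,E_G,\mathrm{col}_G)$ with $V_G=[n]=\{1,\dots,n\}$, $E_G$ a set of unordered pairs of distinct vertices (undirected, no loops), and a vertex labelling $\mathrm{col}_G:V_G\to\mathbb R^\ell$; $N_G(v)=\{u:uv\in E_G\}$. Let $\mathcal G$ be the set of all such graphs. Tensor language $\mathsf{TL}(\Omega)$: let $\Omega$ be a collection of functions, each of the form $f:\mathbb R^p\to\mathbb R$ for some $p\ge1$ depending on $f$. Expressions are generated by $\varphi::=\mathbf 1_{x=y}\mid \mathbf 1_{x\neq y}\mid E(x,y)\mid P_s(x)\mid \varphi\cdot\varphi\mid \varphi+\varphi\mid a\cdot\varphi\mid f(\varphi_1,\dots,\varphi_p)\mid \sum_x\varphi$, with $x,y$ index variables, $s\in[\ell]$, $a\in\mathbb R$, $f\in\Omega$ of arity $p$. Free variables: $\mathrm{free}(\mathbf 1_{x\,\mathrm{op}\,y})=\mathrm{free}(E(x,y))=\{x,y\}$, $\mathrm{free}(P_s(x))=\{x\}$; union of the components' free variables for $\cdot$,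 $+$, $f(\dots)$; $\mathrm{free}(a\cdot\varphi)=\mathrm{free}(\varphi)$; $\mathrm{free}(\sum_x\varphi)=\mathrm{free}(\varphi)\setminus\{x\}$. Semantics: for a graph $G$ and a valuation $\nu$ mapping variables to $V_G$: $[\![E(x,y)]\!]^\nu_G=1$ if $\nu(x)\nu(y)\in E_G$ and $0$ otherwise; $[\![P_s(x)]\!]^\nu_G=\mathrm{col}_G(\nu(x))_s$; $[\![\mathbf 1_{x\,\mathrm{op}\,y}]\!]^\nu_G=1$ if $\nu(x)\,\mathrm{op}\,\nu(y)$ and $0$ otherwise; $\cdot$, $+$, scalar multiplication and $f$ act on values; $[\![\sum_x\varphi]\!]^\nu_G=\sum_{v\in V_G}[\![\varphi]\!]^{\nu[x\mapsto v]}_G$. Summation depth $\mathrm{sd}$: $0$ for atoms, maximum over the components for $\cdot$, $+$, $f(\dots)$, $\mathrm{sd}(a\cdot\varphi)=\mathrm{sd}(\varphi)$, $\mathrm{sd}(\sum_x\varphi)=\mathrm{sd}(\varphi)+1$. $\mathsf{TL}_k(\Omega)$ is the set of expressions in which only variables from $\{x_1,\dots,x_k\}$ occur (free or bound; variables may be re-bound), and $\mathsf{TL}_k^{(t)}(\Omega)$ its subset of summation depth at most $t$. For a set $\mathcal L$ of expressions, $\rho_0(\mathcal L)$ is the set of pairs of graphs $(G,H)$ with $[\![\varphi]\!]_G=[\![\varphi]\!]_H$ for all closed (no free variables) $\varphi\in\mathcal L$. Color refinement: $\mathsf{cr}^{(0)}(G,v)=\mathrm{col}_G(v)$, $\mathsf{cr}^{(t+1)}(G,v)=\bigl(\mathsf{cr}^{(t)}(G,v),\{\!\{\mathsf{cr}^{(t)}(G,u):u\in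 N_G(v)\}\!\}\bigr)$, and $\mathsf{gcr}^{(t)}(G)=\{\!\{\mathsf{cr}^{(t)}(G,v):v\in V_G\}\!\}$ (multisets; labels compared as formal objects across graphs). $k$-dimensional Weisfeiler–Leman ($k\ge1$): for $\mathbf v\in V_G^k$, $\mathsf{atp}_k(G,\mathbf v)$ records, for all $1\le i<j\le k$, whether $v_i=v_j$ and whether $v_iv_j\in E_G$, together with $\mathrm{col}_G(v_i)$ for all $i$. $\mathsf{wl}_k^{(0)}(G,\mathbf v)=\mathsf{atp}_k(G,\mathbf v)$, $\mathsf{wl}_k^{(t+1)}(G,\mathbf v)=\bigl(\mathsf{wl}_k^{(t)}(G,\mathbf v),\{\!\{(\mathsf{atp}_{k+1}(G,(v_1,\dots,v_k,u)),\mathsf{wl}_k^{(t)}(G,\mathbf v[u/1]),\dots,\mathsf{wl}_k^{(t)}(G,\mathbf v[u/k])):u\in V_G\}\!\}\bigr)$, where $\mathbf v[u/i]$ replaces the $i$-th entry by $u$. $\mathsf{gwl}_k^{(t)}(G)=\{\!\{\mathsf{wl}_k^{(t)}(G,\mathbf v):\mathbf v\in V_G^k\}\!\}$. $\rho_0(\mathsf{gcr}^{(t)})=\{(G,H):\mathsf{gcr}^{(t)}(G)=\mathsf{gcr}^{(t)}(H)\}$, $\rho_0(\mathsf{gwl}_k^{(t)})=\{(G,H):\mathsf{gwl}_k^{(t)}(G)=\mathsf{gwl}_k^{(t)}(H)\}$, and $\rho_0(\mathsf{gwl}_k^{(\infty)})=\bigcap_{t\ge0}\rho_0(\mathsf{gwl}_k^{(t)})$.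 *)

(* Defs.v *)
From Stdlib Require Import Reals.
From mathcomp Require Import all_boot.

Set Implicit Arguments.
Unset Strict Implicit.
Unset Printing Implicit Defensive.

Record graph (n l : nat) := Graph {
  gE : rel 'I_n;
  gE_sym : symmetric gE;
  gE_irr : irreflexive gE;
  gcol : 'I_n -> 'I_l -> R
}.

(* Multiset equality {{a_x : x in A}} = {{b_y : y in B}}, where the     *)
(* elements are compared by Rel: there is a bijection f : A -> B      *)
(* (with inverse g) such that Rel x (f x) for every x in A.           *)
Definition mset_eq (I J : finType) (A : pred I) (B : pred J)
  (Rel : I -> J -> Prop) : Prop :=
  exists (f : I -> J) (g : J -> I),
    (forall x, A x -> [/\ B (f x), g (f x) = x & Rel x (f x)]) /\
    (forall y, B y -> A (g y) /\ f (g y) = y).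

Section CR.
Variables (n l : nat) (G H : graph n l).

(* crEq t v w  <->  cr^(t)(G,v) = cr^(t)(H,w) *)
Fixpoint crEq (t : nat) (v w : 'I_n) : Prop :=
  match t with
  | 0 => gcol G v = gcol H w
  | t'.+1 => crEq t' v w /\ mset_eq (gE G v) (gE H w) (crEq t')
  end.

Definition gcrEq (t : nat) : Prop :=
  mset_eq (@predT 'I_n) (@predT 'I_n) (crEq t).
End CR.

Section WL.
Variables (n l : nat) (G H : graph n l).

Definition atpEq (m : nat) (v w : {ffun 'I_m -> 'I_n}) : Prop :=
  (forall i j : 'I_m, i < j ->
     ((v i == v j) = (w i == w j)) /\ (gE G (v i) (v j) = gE H (w i) (w j)))
  /\ (forall i, gcol G (v i) = gcol H (w i)).

(* (v_1,...,v_k,u) *)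
Definition ext (k : nat) (v : {ffun 'I_k -> 'I_n}) (u : 'I_n)
  : {ffun 'I_k.+1 -> 'I_n} :=
  [ffun j : 'I_k.+1 => odflt u (omap v (insub (val j)))].

Definition repl (k : nat) (v : {ffun 'I_k -> 'I_n}) (i : 'I_k) (u : 'I_n)
  : {ffun 'I_k -> 'I_n} :=
  [ffun j => if j == i then u else v j].

Variable k : nat.

(* wlEq t v w  <->  wl_k^(t)(G,v) = wl_k^(t)(H,w) *)
Fixpoint wlEq (t : nat) (v w : {ffun 'I_k -> 'I_n}) : Prop :=
  match t with
  | 0 => atpEq v w
  | t'.+1 => wlEq t' v w /\
      mset_eq (@predT 'I_n) (@predT 'I_n)
        (fun u u' => atpEq (ext v u) (ext w u') /\
                     forall i : 'I_k, wlEq t' (repl v i u) (repl w i u'))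
  end.

Definition gwlEq (t : nat) : Prop :=
  mset_eq (@predT {ffun 'I_k -> 'I_n}) (@predT {ffun 'I_k -> 'I_n}) (wlEq t).

Definition gwlEq_inf : Prop := forall t, gwlEq t.
End WL.

(* Index variables are natural numbers; variable x_i is encoded as i-1 *)
(* so "only variables from {x_1,...,x_k}" means "all variables < k".   *)
Inductive expr (l : nat) : Type :=
| EEq   : nat -> nat -> expr l
| ENeq  : nat -> nat -> expr l
| EEdge : nat -> nat -> expr l
| ELab  : 'I_l -> nat -> expr l
| EMul  : expr l -> expr l -> expr l
| EAdd  : expr l -> expr l -> expr l
| EScal : R -> expr l -> expr l
| EApp  : forall p : nat, (('I_p -> R) -> R) -> ('I_p -> expr l) -> expr l
| ESum  : nat -> expr l -> expr l.

Section TL.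
Variable l : nat.

Fixpoint inOmega (Omega : forall p, (('I_p -> R) -> R) -> Prop) (e : expr l)
  : Prop :=
  match e with
  | EEq _ _ | ENeq _ _ | EEdge _ _ | ELab _ _ => True
  | EMul a b | EAdd a b => inOmega Omega a /\ inOmega Omega b
  | EScal _ a => inOmega Omega a
  | EApp p f args => Omega p f /\ forall i, inOmega Omega (args i)
  | ESum _ a => inOmega Omega a
  end.

Fixpoint varsBelow (k : nat) (e : expr l) : Prop :=
  match e with
  | EEq x y | ENeq x y | EEdge x y => x < k /\ y < k
  | ELab _ x => x < k
  | EMul a b | EAdd a b => varsBelow k a /\ varsBelow k b
  | EScal _ a => varsBelow k a
  | EApp p f args => forall i, varsBelow k (args i)
  | ESum x a => x < k /\ varsBelow k a
  end.

Fixpoint isFree (z : nat) (e : expr l) : Prop :=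
  match e with
  | EEq x y | ENeq x y | EEdge x y => z = x \/ z = y
  | ELab _ x => z = x
  | EMul a b | EAdd a b => isFree z a \/ isFree z b
  | EScal _ a => isFree z a
  | EApp p f args => exists i, isFree z (args i)
  | ESum x a => z <> x /\ isFree z a
  end.

Definition closed (e : expr l) : Prop := forall z, ~ isFree z e.

Fixpoint sd (e : expr l) : nat :=
  match e with
  | EEq _ _ | ENeq _ _ | EEdge _ _ | ELab _ _ => 0
  | EMul a b | EAdd a b => maxn (sd a) (sd b)
  | EScal _ a => sd a
  | EApp p f args => \max_(i < p) sd (args i)
  | ESum _ a => (sd a).+1
  end.

Variable n : nat.

Definition upd (nu : nat -> 'I_n) (x : nat) (v : 'I_n) : nat -> 'I_n :=
  fun z => if z == x then v else nu z.

Definition sumV (f : 'I_n -> R) : R := \big[Rplus/R0]_(v : 'I_n) f v.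

Definition ind (b : bool) : R := if b then R1 else R0.

Fixpoint eval (G : graph n l) (nu : nat -> 'I_n) (e : expr l) : R :=
  match e with
  | EEq x y => ind (nu x == nu y)
  | ENeq x y => ind (nu x != nu y)
  | EEdge x y => ind (gE G (nu x) (nu y))
  | ELab s x => gcol G (nu x) s
  | EMul a b => Rmult (eval G nu a) (eval G nu b)
  | EAdd a b => Rplus (eval G nu a) (eval G nu b)
  | EScal c a => Rmult c (eval G nu a)
  | EApp p f args => f (fun i => eval G nu (args i))
  | ESum x a => sumV (fun v => eval G (upd nu x v) a)
  end.

(* For closed e the value does not depend on nu; we quantify over nu. *)
Definition rho0_TLt (Omega : forall p, (('I_p -> R) -> R) -> Prop)
  (k t : nat) (G H : graph n l) : Prop :=
  forall e : expr l, inOmega Omega e -> varsBelow k e -> sd e <= t ->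
    closed e -> forall nu, eval G nu e = eval H nu e.

Definition rho0_TL (Omega : forall p, (('I_p -> R) -> R) -> Prop)
  (k : nat) (G H : graph n l) : Prop :=
  forall e : expr l, inOmega Omega e -> varsBelow k e ->
    closed e -> forall nu, eval G nu e = eval H nu e.
End TL.

(* Main.v *)
(* From expressions to refinement: two valuated graphs agreeing on all
   expressions of bounded depth have equal colours. Expressions separate any two
   points that do not agree, so products of affine combinations of them give the
   indicator of an agreement class on finitely many points, and summing this
   indicator compares the sizes of the classes; equal sizes yield the bijections
   required by WL. No function of Omega is used here.

   From refinement to expressions: evaluation is invariant under the
   bisimulation obtained from stable k-WL on (k+1)-tuples, respectively from
   bounded colour refinement on pairs; a sum is handled by the bijection between
   its summands. In the depth-bounded case a closed expression combines sums
   over a single free variable, so its outermost summation is paid for by the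
   global multiset: this is why depth t.+1 matches t rounds. *)
From HB Require Import structures.
Require Import Defs.
From Stdlib Require Import Reals Lra.
From mathcomp Require Import all_boot boolp.

Set Implicit Arguments.
Unset Strict Implicit.
Unset Printing Implicit Defensive.

(** * Multiset equality, class counting and finite real sums *)

HB.instance Definition _ := Monoid.isComLaw.Build R R0 Rplus
  (fun x y z => esym (Rplus_assoc x y z)) Rplus_comm Rplus_0_l.

Lemma mset_eq_sym (I J : finType) (A : pred I) (B : pred J)
  (Rel : I -> J -> Prop) :
  mset_eq A B Rel -> mset_eq B A (fun j i => Rel i j).
Proof.
move=> [f [g [fP gP]]]; exists g, f; split=> [y By|x Ax].
  have [Agy fgy] := gP y By; split=> //.
  by have [_ _] := fP _ Agy; rewrite fgy.
by have [] := fP x Ax.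
Qed.

Lemma mset_eq_impl (I J : finType) (A : pred I) (B : pred J)
  (Rel Rel' : I -> J -> Prop) :
  (forall i j, A i -> B j -> Rel i j -> Rel' i j) ->
  mset_eq A B Rel -> mset_eq A B Rel'.
Proof.
move=> imp [f [g [fP gP]]]; exists f, g; split=> // x Ax.
by have [Bfx gfx Rx] := fP x Ax; split=> //; apply: imp.
Qed.

Lemma mset_eqU (I J : finType) (A A' : pred I) (B B' : pred J)
  (Rel : I -> J -> Prop) :
  (forall i, A i -> ~~ A' i) -> (forall j, B j -> ~~ B' j) ->
  mset_eq A B Rel -> mset_eq A' B' Rel ->
  mset_eq (predU A A') (predU B B') Rel.
Proof.
move=> dA dB [f [g [fP gP]]] [f' [g' [fP' gP']]].
exists (fun i => if A i then f i else f' i).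
exists (fun j => if B j then g j else g' j); split=> [x|y] /=.
  case Ax: (A x) => /=.
    by move=> _; have [Bf gf Rf] := fP x Ax; split; rewrite ?Bf.
  move=> A'x; have [B'f gf Rf] := fP' x A'x.
  have nB: B (f' x) = false by apply/negP => /dB; rewrite B'f.
  by split; rewrite ?nB.
case By: (B y) => /=.
  by move=> _; have [Ag fg] := gP y By; rewrite Ag.
move=> B'y; have [A'g fg] := gP' y B'y.
have nA: A (g' y) = false by apply/negP => /dA; rewrite A'g.
by rewrite nA.
Qed.

Lemma mset_eq_sum (I J : finType) (Rel : I -> J -> Prop)
  (F : I -> R) (F' : J -> R) :
  mset_eq predT predT Rel -> (forall i j, Rel i j -> F i = F' j) ->
  \big[Rplus/R0]_i F i = \big[Rplus/R0]_j F' j.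
Proof.
move=> [f [g [fP gP]]] FF'.
have fK : cancel f g by move=> x; have [] := fP x isT.
have gK : cancel g f by move=> y; have [] := gP y isT.
rewrite (reindex f) /=; last by apply: onW_bij; exists g.
by apply: eq_bigr => i _; apply: FF'; have [] := fP i isT.
Qed.

Section MsetEquiv.
Variables (I : finType) (T : Type) (p q : I -> T) (E : T -> T -> Prop).
Hypothesis Erefl : forall x, E x x.
Hypothesis Esym : forall x y, E x y -> E y x.
Hypothesis Etrans : forall x y z, E x y -> E y z -> E x z.

Let cls (A : pred I) (r : I -> T) (x : T) := [pred i | A i && `[< E (r i) x >]].

Lemma mset_eq_card_le (A B : pred I) (r s : I -> T) x :
  mset_eq A B (fun i j => E (r i) (s j)) -> #|cls A r x| <= #|cls B s x|.
Proof.
move=> [f [g [fP gP]]].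
have finj : {in cls A r x &, injective f}.
  move=> i j /andP[Ai _] /andP[Aj _] eqf.
  by have [_ <- _] := fP i Ai; have [_ <- _] := fP j Aj; rewrite eqf.
rewrite -(card_in_image finj); apply: subset_leq_card.
apply/subsetP => _ /imageP[i /andP[Ai /asboolP Ei] ->].
have [Bf _ Rf] := fP i Ai; apply/andP; split=> //.
by apply/asboolP; apply: Etrans Ei; apply: Esym.
Qed.

(** Reduces the search for a bijection to counting. A bijection along [E] injects each class into
    its counterpart in both directions; conversely, classes of equal size can be matched element by
    element through their enumerations. *)
Lemma card_mset_eq (A B : pred I) :
  (forall x, #|cls A p x| = #|cls B q x|) <->
  mset_eq A B (fun i j => E (p i) (q j)).
Proof.
split=> [ceq|AB x]; last first.
  apply/eqP; rewrite eqn_leq mset_eq_card_le //=.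
  apply: mset_eq_card_le; apply: mset_eq_impl (mset_eq_sym AB) => i j _ _.
  exact: Esym.
have cls_eq (D : pred I) r x y : E x y -> cls D r x =i cls D r y.
  move=> xy i; rewrite !inE; congr (_ && _).
  apply/asboolP/asboolP => Ei; first exact: Etrans xy.
  by apply: Etrans (Esym xy).
(* [tr] sends [i] to the element of the same rank in the corresponding class on the other side. The
   default [i] of [nth] is never reached, since equal class sizes keep the rank in range. *)
pose tr (D D' : pred I) (r r' : I -> T) i :=
  nth i (enum (cls D' r' (r i))) (index i (enum (cls D r (r i)))).
have trP (D D' : pred I) r r' :
    (forall x, #|cls D r x| = #|cls D' r' x|) -> forall i, D i ->
    [/\ D' (tr D D' r r' i), tr D' D r' r (tr D D' r r' i) = i
      & E (r i) (r' (tr D D' r r' i))].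
  move=> card_eq i Di.
  have ini : i \in enum (cls D r (r i)).
    by rewrite mem_enum inE Di; apply/asboolP.
  have lti : index i (enum (cls D r (r i))) < size (enum (cls D' r' (r i))).
    by rewrite -cardE -card_eq cardE index_mem.
  have := mem_nth i lti; rewrite mem_enum => /andP[D'j /asboolP Ej].
  split=> //; last exact: Esym.
  (* The class of the image is the class of [i], so both directions read the same two enumerations
     and the ranks cancel. *)
  rewrite {1}/tr (eq_enum (cls_eq D r _ _ Ej)) (eq_enum (cls_eq D' r' _ _ Ej)).
  by rewrite index_uniq ?enum_uniq // (set_nth_default i) ?nth_index ?index_mem.
exists (tr A B p q), (tr B A q p); split=> [x Ax|y By].
  exact: trP.
by have [] := trP B A q p (fun x => esym (ceq x)) y By.
Qed.

(** Class sizes can be subtracted: the complements match although the bijection on everything need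
    not extend the one between [A] and [B]. *)
Lemma mset_eqC (A B : pred I) :
  mset_eq A B (fun i j => E (p i) (q j)) ->
  mset_eq predT predT (fun i j => E (p i) (q j)) ->
  mset_eq (predC A) (predC B) (fun i j => E (p i) (q j)).
Proof.
move=> /card_mset_eq AB /card_mset_eq TT; apply/card_mset_eq => x.
have split_cls D r : #|cls predT r x| = #|cls D r x| + #|cls (predC D) r x|.
  rewrite -(cardID D (cls predT r x)); congr (_ + _).
  by apply: eq_card => i; rewrite !inE /= andbC.
by have := TT x; rewrite (split_cls A) (split_cls B) AB => /addnI.
Qed.

End MsetEquiv.

(** * Swaps of variables, and the passage between valuations and tuples *)

Definition swap (a b z : nat) : nat :=
  if z == a then b else if z == b then a else z.

Lemma swapK a b : involutive (swap a b).
Proof.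
move=> z; rewrite /swap; case: (eqVneq z a) => [->|za].
  by case: (eqVneq b a); rewrite ?eqxx.
by case: (eqVneq z b) => [->|zb]; rewrite ?eqxx ?(negPf za) ?(negPf zb).
Qed.

Lemma swap_lt a b m z : a < m -> b < m -> z < m -> swap a b z < m.
Proof. by rewrite /swap; do 2?case: ifP. Qed.

Lemma swapr a b : swap a b b = a.
Proof. by rewrite /swap eqxx; case: eqP. Qed.

Lemma upd_inj n (nu : nat -> 'I_n) (s : nat -> nat) x v :
  injective s -> upd nu (s x) v \o s = upd (nu \o s) x v.
Proof. by move=> s_inj; apply/funext => z; rewrite /upd /= (inj_eq s_inj). Qed.

Definition restrict n (m : nat) (nu : nat -> 'I_n) : {ffun 'I_m -> 'I_n} :=
  [ffun i : 'I_m => nu i].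

Lemma eq_restrict n m (nu mu : nat -> 'I_n) :
  (forall z, z < m -> nu z = mu z) -> restrict m nu = restrict m mu.
Proof. by move=> e; apply/ffunP => i; rewrite !ffunE e. Qed.

(** With tuples read as the first variables of a valuation, both tuple operations of WL become
    updates: appending an entry updates variable [m], and replacing entry [i] updates variable
    [i]. *)
Lemma ext_restrict n m (nu : nat -> 'I_n) u :
  ext (restrict m nu) u = restrict m.+1 (upd nu m u).
Proof.
apply/ffunP => j; rewrite !ffunE /upd; case: insubP => [i lt_jm <-|] /=.
  by rewrite ffunE ltn_eqF.
by rewrite -leqNgt => le_mj; rewrite eqn_leq le_mj -ltnS ltn_ord.
Qed.

Lemma repl_restrict n m (nu : nat -> 'I_n) (i : 'I_m) u :
  repl (restrict m nu) i u = restrict m (upd nu i u).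
Proof. by apply/ffunP => j; rewrite !ffunE. Qed.

Definition override n (nu : nat -> 'I_n) m (v : {ffun 'I_m -> 'I_n}) (z : nat) :=
  oapp v (nu z) (insub z).

Lemma restrict_override n (nu : nat -> 'I_n) m (v : {ffun 'I_m -> 'I_n}) :
  restrict m (override nu v) = v.
Proof. by apply/ffunP => i; rewrite ffunE /override valK. Qed.

Lemma override_ext n (nu : nat -> 'I_n) m (v : {ffun 'I_m -> 'I_n}) u :
  override nu (ext v u) = upd (override nu v) m u.
Proof.
apply/funext => z; rewrite /override /upd; case: insubP => [j _ <-|] /=.
  rewrite ffunE; case: insubP => [i _ <-|] /=; first by rewrite ltn_eqF.
  by rewrite -leqNgt => le_mj; rewrite eqn_leq le_mj -ltnS ltn_ord.
rewrite -leqNgt => lt_mz; rewrite gtn_eqF //.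
by case: insubP => // i; rewrite ltnNge ltnW.
Qed.

Lemma sum_ext n m (F : {ffun 'I_m.+1 -> 'I_n} -> R) :
  \big[Rplus/R0]_w F w = \big[Rplus/R0]_v \big[Rplus/R0]_u F (ext v u).
Proof.
rewrite pair_big (reindex (fun p : {ffun 'I_m -> 'I_n} * 'I_n => ext p.1 p.2)) //.
pose sp (w : {ffun 'I_m.+1 -> 'I_n}) : {ffun 'I_m -> 'I_n} * 'I_n :=
  ([ffun i => w (widen_ord (leqnSn m) i)], w ord_max).
exists sp => [[v u] _|w _]; rewrite /sp /=.
  congr (_, _); last by rewrite ffunE insubF //= ltnn.
  apply/ffunP => i; rewrite !ffunE; case: insubP => [j _ /= e|] /=.
    by congr (v _); apply: val_inj.
  by rewrite ltn_ord.
apply/ffunP => j; rewrite ffunE; case: insubP => [i _ /= e|] /=.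
  by rewrite ffunE; congr (w _); apply: val_inj.
rewrite -leqNgt => le_mj; congr (w _); apply: val_inj.
by apply/eqP; rewrite /= eqn_leq le_mj -ltnS ltn_ord.
Qed.

(** * Dependence on free variables, and renaming *)

Section Syntax.
Variables (l n : nat).
Implicit Types (e : expr l) (G H : graph n l) (nu mu : nat -> 'I_n).

Lemma eval_ext G nu mu e :
  (forall z, isFree z e -> nu z = mu z) -> eval G nu e = eval G mu e.
Proof.
elim: e nu mu => [x y|x y|x y|s x|a IHa b IHb|a IHa b IHb|c a IHa|p f args IH|x a IHa]
    nu mu /= e.
- by rewrite !e //; [right|left].
- by rewrite !e //; [right|left].
- by rewrite !e //; [right|left].
- by rewrite e.
- by rewrite (IHa nu mu) ?(IHb nu mu) // => z zF; apply: e; [right|left].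
- by rewrite (IHa nu mu) ?(IHb nu mu) // => z zF; apply: e; [right|left].
- by rewrite (IHa nu mu).
- congr f; apply/funext => i; apply: IH => z zF; apply: e; by exists i.
- apply: eq_bigr => v _; apply: IHa => z zF; rewrite /upd.
  by case: eqP => // zx; apply: e.
Qed.

(** Bound variables are renamed as well, so an injective [s] causes no capture and no fresh variable
    has to be found within the variable bound. *)
Fixpoint rename (s : nat -> nat) e : expr l :=
  match e with
  | EEq x y => EEq _ (s x) (s y)
  | ENeq x y => ENeq _ (s x) (s y)
  | EEdge x y => EEdge _ (s x) (s y)
  | ELab i x => ELab i (s x)
  | EMul a b => EMul (rename s a) (rename s b)
  | EAdd a b => EAdd (rename s a) (rename s b)
  | EScal c a => EScal c (rename s a)
  | EApp p f args => EApp f (fun i => rename s (args i))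
  | ESum x a => ESum (s x) (rename s a)
  end.

Lemma eval_rename G s nu e :
  injective s -> eval G nu (rename s e) = eval G (nu \o s) e.
Proof.
move=> s_inj.
elim: e nu => //= [a IHa b IHb|a IHa b IHb|c a IHa|p f args IH|x a IHa] nu.
- by rewrite IHa IHb.
- by rewrite IHa IHb.
- by rewrite IHa.
- by congr f; apply/funext => i; apply: IH.
- by apply: eq_bigr => v _; rewrite IHa upd_inj.
Qed.

Lemma inOmega_rename (Omega : forall p, (('I_p -> R) -> R) -> Prop) s e :
  inOmega Omega e -> inOmega Omega (rename s e).
Proof.
elim: e => //= [a IHa b IHb|a IHa b IHb|p f args IH].
- by case=> /IHa ? /IHb ?.
- by case=> /IHa ? /IHb ?.
- by case=> ? h; split=> // i; apply/IH.
Qed.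

Lemma varsBelow_rename s K e : (forall z, z < K -> s z < K) ->
  varsBelow K e -> varsBelow K (rename s e).
Proof.
move=> sK; elim: e => //= [x y|x y|x y|a IHa b IHb|a IHa b IHb|p f args IH|x a IHa].
- by case=> /sK ? /sK.
- by case=> /sK ? /sK.
- by case=> /sK ? /sK.
- by case=> /IHa ? /IHb.
- by case=> /IHa ? /IHb.
- by move=> h i; apply/IH.
- by case=> /sK ? /IHa.
Qed.

Lemma sd_rename s e : sd (rename s e) = sd e.
Proof.
elim: e => //= [a -> b ->|a -> b ->|p f args IH|x a ->] //.
by apply: eq_bigr => i _; apply: IH.
Qed.

Lemma isFree_rename s z e : isFree z (rename s e) ->
  exists2 y, isFree y e & z = s y.
Proof.
elim: e => //= [x y|x y|x y|i x|a IHa b IHb|a IHa b IHb|p f args IH|x a IHa].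
- by case=> ->; [exists x|exists y]; auto.
- by case=> ->; [exists x|exists y]; auto.
- by case=> ->; [exists x|exists y]; auto.
- by move=> ->; exists x.
- by case=> [/IHa|/IHb] [y yF ->]; exists y; auto.
- by case=> [/IHa|/IHb] [y yF ->]; exists y; auto.
- by case=> i /IH [y yF ->]; exists y => //; exists i.
- by case=> zx /IHa [y yF zy]; exists y => //; split=> // yx; rewrite zy yx in zx.
Qed.

End Syntax.

(** * Agreement on expressions of bounded depth *)

Section Agreement.
Variables (l n : nat) (Omega : forall p, (('I_p -> R) -> R) -> Prop).
Implicit Types (e : expr l) (G H : graph n l) (nu mu : nat -> 'I_n).

(** [K] bounds all variables that occur, [m] only the free ones; the gap between them leaves spare
    variables to sum over. *)
Definition admissible (K t m : nat) e : Prop :=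
  [/\ inOmega Omega e, varsBelow K e, sd e <= t & forall z, isFree z e -> z < m].

Definition agree (K t m : nat) (p q : graph n l * (nat -> 'I_n)) : Prop :=
  forall e, admissible K t m e -> eval p.1 p.2 e = eval q.1 q.2 e.

Lemma agree_le K t t' m m' p q : t' <= t -> m' <= m ->
  agree K t m p q -> agree K t' m' p q.
Proof.
move=> tt mm pq e [eO eK et em]; apply: pq; split=> //; first exact: leq_trans tt.
by move=> z /em zm; apply: leq_trans mm.
Qed.

Lemma admissible_mul K t m a b :
  admissible K t m a -> admissible K t m b -> admissible K t m (EMul a b).
Proof.
case=> ? ? ? am [? ? ? bm]; split; rewrite //= ?geq_max; first exact/andP.
by move=> z [/am|/bm].
Qed.

Lemma admissible_add K t m a b :
  admissible K t m a -> admissible K t m b -> admissible K t m (EAdd a b).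
Proof.
case=> ? ? ? am [? ? ? bm]; split; rewrite //= ?geq_max; first exact/andP.
by move=> z [/am|/bm].
Qed.

Lemma admissible_scal K t m c a :
  admissible K t m a -> admissible K t m (EScal c a).
Proof. by case. Qed.

(** The grammar has no constants; the atom [EEq l 0 0] serves as 1. It has variable 0 free, whence
    [0 < m]. *)
Lemma admissible_one K t m : 0 < m -> m <= K -> admissible K t m (EEq l 0 0).
Proof.
move=> m0 mK; have K0 := leq_trans m0 mK.
by split=> //= z [->|->].
Qed.

Lemma admissible_sum K t m e : m < K ->
  admissible K t m.+1 e -> admissible K t.+1 m (ESum m e).
Proof.
move=> mK [eO eK et em]; split=> //= z [/eqP zm /em].
by rewrite ltnS leq_eqVlt (negPf zm).
Qed.

(* On finitely many points [r j], the agreement class of [p] has an admissible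
   indicator: multiply the factors (f - b) / (a - b), where f takes the value a
   at [p] and b at a point it separates from [p]. *)
Lemma agree_indicator (J : finType) (r : J -> graph n l * (nat -> 'I_n)) K t m p :
  0 < m -> m <= K ->
  exists2 h, admissible K t m h & eval p.1 p.2 h = R1 /\
    forall j, ~ agree K t m p (r j) -> eval (r j).1 (r j).2 h = R0.
Proof.
move=> m0 mK; have one G nu : eval G nu (EEq l 0 0) = R1 by rewrite /= eqxx.
suff [h hA [hp hr]] : exists2 h, admissible K t m h & eval p.1 p.2 h = R1 /\
    forall j, j \in enum J -> ~ agree K t m p (r j) -> eval (r j).1 (r j).2 h = R0.
  by exists h => //; split=> // j; apply: hr; rewrite mem_enum.
elim: (enum J) => [|j s [h hA [hp hr]]].
  by exists (EEq l 0 0); [apply: admissible_one|split=> //; apply: one].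
have [pj|npj] := pselect (agree K t m p (r j)).
  by exists h => //; split=> // i; rewrite inE => /orP[/eqP ->|/hr].
have [f fA fpj] : exists2 f, admissible K t m f &
    eval p.1 p.2 f <> eval (r j).1 (r j).2 f.
  by apply: contra_notP npj => nf f fA; apply: contra_notP nf => fpj; exists f.
set a := eval p.1 p.2 f in fpj; set b := eval (r j).1 (r j).2 f in fpj.
exists (EMul h (EScal (Rinv (Rminus a b)) (EAdd f (EScal (Ropp b) (EEq l 0 0))))).
  apply/admissible_mul/admissible_scal/admissible_add/admissible_scal => //.
  exact: admissible_one.
split=> [|i]; first by rewrite /= eqxx hp -/a /Defs.ind; field; lra.
rewrite inE => /orP[/eqP -> _|si npi] /=.
  by rewrite eqxx -/b /Defs.ind; ring.
by rewrite hr //; ring.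
Qed.

(** The sum of the indicator of a class over a family is the number of members in that class, so
    equal sums force equal class sizes. *)
Lemma mset_eq_agree (I : finType) (p q : I -> graph n l * (nat -> 'I_n)) K t m :
  0 < m -> m <= K ->
  (forall h, admissible K t m h ->
     \big[Rplus/R0]_i eval (p i).1 (p i).2 h =
     \big[Rplus/R0]_i eval (q i).1 (q i).2 h) ->
  mset_eq predT predT (fun i j => agree K t m (p i) (q j)).
Proof.
move=> m0 mK sums.
have sym x y : agree K t m x y -> agree K t m y x by move=> xy e /xy.
have trans x y z : agree K t m x y -> agree K t m y z -> agree K t m x z.
  by move=> xy yz e eA; rewrite xy ?yz.
apply/card_mset_eq => // x.
(* Taking both families together yields a single [h] that is an indicator on each of them. *)
pose r (s : I + I) := match s with inl i => p i | inr i => q i end.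
have [h hA [hx hr]] := agree_indicator r t x m0 mK.
have sum_card (s : I -> graph n l * (nat -> 'I_n)) :
    (forall i, ~ agree K t m x (s i) -> eval (s i).1 (s i).2 h = R0) ->
    \big[Rplus/R0]_i eval (s i).1 (s i).2 h =
    INR #|[pred i | predT i && `[< agree K t m (s i) x >]]|.
  move=> hs; set P := [pred i | _].
  rewrite (bigID P) /= [X in Rplus _ X]big1 => [|i]; last first.
    by move=> /asboolPn nsi; apply: hs => /sym.
  rewrite Rplus_0_r (eq_bigr (fun=> R1)) => [|i /asboolP si]; last by rewrite si.
  rewrite big_const; elim: #|_| => // c IH.
  by rewrite [LHS]/= IH S_INR Rplus_comm.
apply: INR_eq; rewrite -(sum_card p) => [|i]; last exact: (hr (inl i)).
by rewrite -(sum_card q) ?sums // => i; apply: (hr (inr i)).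
Qed.

End Agreement.

(** * Atomic types of valuations *)

Section AtomicTypes.
Variables (l n : nat).
Implicit Types (G H : graph n l) (nu mu : nat -> 'I_n).

(** [atpEq] only compares positions [i < j]; symmetry of the edge relation and absence of loops
    extend this to all pairs of variables. *)
Lemma atpEq_restrict G H m nu mu :
  atpEq G H (restrict m nu) (restrict m mu) <->
  (forall x y, x < m -> y < m -> (nu x == nu y) = (mu x == mu y) /\
     gE G (nu x) (nu y) = gE H (mu x) (mu y)) /\
  (forall x, x < m -> gcol G (nu x) = gcol H (mu x)).
Proof.
split=> [[E C]|[E C]]; split.
- move=> x y xm ym; case: (ltngtP x y) => [xy|yx|->].
  + by have := E (Ordinal xm) (Ordinal ym) xy; rewrite !ffunE.
  + have := E (Ordinal ym) (Ordinal xm) yx; rewrite !ffunE /=.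
    by rewrite eq_sym (eq_sym (mu x)) gE_sym (gE_sym H (mu x)).
  + by rewrite !eqxx !gE_irr.
- by move=> x xm; have := C (Ordinal xm); rewrite !ffunE.
- by move=> i j _; rewrite !ffunE; apply: E.
- by move=> i; rewrite !ffunE; apply: C.
Qed.

Lemma atpEq_comp G H m m' nu mu s : (forall z, z < m' -> s z < m) ->
  atpEq G H (restrict m nu) (restrict m mu) ->
  atpEq G H (restrict m' (nu \o s)) (restrict m' (mu \o s)).
Proof.
move=> sm /atpEq_restrict [E C]; apply/atpEq_restrict; split=> [x y xm ym|x xm].
  by apply: E; apply: sm.
by apply: C; apply: sm.
Qed.

(** Replacing entry [i] amounts to writing [u] into the spare variable [m] and swapping: the old
    entry moves to position [m] and is cut off. *)
Lemma restrict_swap m i nu u : i < m ->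
  restrict m (upd nu m u \o swap i m) = restrict m (upd nu i u).
Proof.
move=> im; apply: eq_restrict => z zm; rewrite /upd /swap /=.
case: (eqVneq z i) => [_|zi]; first by rewrite eqxx.
by rewrite !(ltn_eqF zm).
Qed.

Lemma ind_inj : injective Defs.ind.
Proof. by move=> [] [] //; rewrite /Defs.ind; lra. Qed.

End AtomicTypes.

(** * From expressions to WL colours *)

Section ExpressionsToWL.
Variables (l n : nat) (Omega : forall p, (('I_p -> R) -> R) -> Prop).
Implicit Types (e : expr l) (G H : graph n l) (nu mu : nat -> 'I_n).

Lemma admissible_rename K t m m' s e :
  (forall z, z < K -> s z < K) -> (forall z, z < m -> s z < m') ->
  admissible Omega K t m e -> admissible Omega K t m' (rename s e).
Proof.
move=> sK sm [eO eK et em]; split.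
- exact: inOmega_rename.
- exact: varsBelow_rename.
- by rewrite sd_rename.
- by move=> z /isFree_rename [y /em ym ->]; apply: sm.
Qed.

Lemma agree_atp K t m G H nu mu : m <= K ->
  agree Omega K t m (G, nu) (H, mu) -> atpEq G H (restrict m nu) (restrict m mu).
Proof.
move=> mK a; apply/atpEq_restrict; split=> [x y xm ym|x xm].
  have xK := leq_trans xm mK; have yK := leq_trans ym mK.
  split; apply: ind_inj.
    by apply: (a (EEq l x y)); split=> //= z [->|->].
  by apply: (a (EEdge l x y)); split=> //= z [->|->].
apply/funext => s; apply: (a (ELab s x)); split=> //=; first exact: leq_trans mK.
by move=> z ->.
Qed.

(** Each round costs one summation over the spare variable [k]: equality of all such sums gives a
    bijection between the vertices [u] and [u'] along which the extended valuations agree at depth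
    [t]. *)
Lemma agree_wl k t G H nu mu : 0 < k ->
  agree Omega k.+1 t k (G, nu) (H, mu) -> wlEq G H t (restrict k nu) (restrict k mu).
Proof.
move=> k0; elim: t nu mu => [|t IH] nu mu a /=; first exact: agree_atp a.
split; first by apply: IH; apply: agree_le a.
apply: (@mset_eq_impl _ _ _ _ (fun u u' =>
  agree Omega k.+1 t k.+1 (G, upd nu k u) (H, upd mu k u'))) => [u u' _ _ b|].
  split=> [|i]; first by rewrite !ext_restrict; apply: agree_atp b.
  (* Replaced tuples are reached by renaming along the swap of [i] and [k], which keeps the depth
     and stays within [k.+1] variables. *)
  rewrite !repl_restrict -!(restrict_swap _ _ (ltn_ord i)); apply: IH => e eA /=.
  have swap_inj := inv_inj (swapK i k).
  have sK z : z < k.+1 -> swap i k z < k.+1 by apply: swap_lt => //; apply: leqW.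
  rewrite -!eval_rename //; apply: b; apply: admissible_rename eA => // z zk.
  exact/sK/leqW.
apply: (mset_eq_agree (p := fun u => (G, upd nu k u))
  (q := fun u => (H, upd mu k u))) => // h hA.
by apply: (a (ESum k h)); apply: admissible_sum.
Qed.

Fixpoint sums m e : expr l := if m is m'.+1 then sums m' (ESum m' e) else e.

Lemma admissible_sums K t m e : m <= K ->
  admissible Omega K t m e -> admissible Omega K (m + t) 0 (sums m e).
Proof.
elim: m t e => //= m IH t e mK eA; rewrite addSnnS; apply: IH; first exact: ltnW.
exact: admissible_sum.
Qed.

Lemma eval_sums G nu m e :
  eval G nu (sums m e) =
  \big[Rplus/R0]_(v : {ffun 'I_m -> 'I_n}) eval G (override nu v) e.
Proof.
elim: m e => [|m IH] e /=.
  have v0 (v : {ffun 'I_0 -> 'I_n}) : override nu v = nu.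
    by apply/funext => z; rewrite /override insubF.
  rewrite (eq_bigr (fun=> eval G nu e)) => [|v _]; last by rewrite v0.
  rewrite big_const.
  have -> : #|{: {ffun 'I_0 -> 'I_n}}| = 1 by rewrite card_ffun !card_ord expn0.
  by rewrite /= Rplus_0_r.
rewrite IH sum_ext; apply: eq_bigr => v _; apply: eq_bigr => u _.
by rewrite override_ext.
Qed.

(** The depth [k + t] splits into [k] outer sums, which range over all tuples, and [t] sums for the
    rounds. *)
Lemma rho0_TLt_gwl k t G H : 0 < n -> 0 < k ->
  rho0_TLt Omega k.+1 (k + t) G H -> gwlEq G H k t.
Proof.
move=> n0 k0 GH; pose nu (_ : nat) := Ordinal n0.
apply: (@mset_eq_impl _ _ _ _ (fun v w =>
  agree Omega k.+1 t k (G, override nu v) (H, override nu w))) => [v w _ _ a|].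
  by have := agree_wl k0 a; rewrite !restrict_override.
apply: (mset_eq_agree (p := fun v => (G, override nu v))
  (q := fun v => (H, override nu v))) => // h hA /=.
rewrite -!eval_sums; have [? ? ? hF] := admissible_sums (leqnSn k) hA.
by apply: GH => // z /hF.
Qed.

End ExpressionsToWL.

(** * From stable WL colours to expressions *)

Section WLToExpressions.
Variables (l n k : nat) (G H : graph n l).
Implicit Types (e : expr l) (nu mu : nat -> 'I_n).

Lemma wlEq_le t t' (v w : {ffun 'I_k -> 'I_n}) :
  t' <= t -> wlEq G H t v w -> wlEq G H t' v w.
Proof.
elim: t => [|t IH]; first by rewrite leqn0 => /eqP ->.
by rewrite leq_eqVlt => /orP[/eqP ->|] // tt [/(IH tt)].
Qed.

(** There are finitely many pairs of tuples, and each pair that is ever separated is separated at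
    some round; [T] is the maximum of these rounds. *)
Lemma wlEq_stable : exists T, forall v w : {ffun 'I_k -> 'I_n},
  wlEq G H T v w -> forall t, wlEq G H t v w.
Proof.
have [|f fP] := @fin_all_exists ({ffun 'I_k -> 'I_n} * {ffun 'I_k -> 'I_n})%type
    (fun=> nat) (fun p T => wlEq G H T p.1 p.2 -> forall t, wlEq G H t p.1 p.2).
  move=> [v w] /=; have [all_t|] := pselect (forall t, wlEq G H t v w).
    by exists 0.
  by move=> /existsNP [t nt]; exists t.
exists (\max_p f p) => v w vw; apply: (fP (v, w)) => /=.
by apply: wlEq_le vw; apply: leq_bigmax.
Qed.

(** Permuting coordinates respects every round. The condition [s k = k] keeps the appended vertex in
    last position. *)
Lemma wlEq_perm t s nu mu : injective s -> (forall z, z < k -> s z < k) -> s k = k ->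
  wlEq G H t (restrict k nu) (restrict k mu) ->
  wlEq G H t (restrict k (nu \o s)) (restrict k (mu \o s)).
Proof.
move=> s_inj sk skk; elim: t nu mu => [|t IH] nu mu /=; first exact: atpEq_comp.
case=> vw m; split; first exact: IH.
apply: mset_eq_impl m => u u' _ _ [a r]; split=> [|i].
  rewrite !ext_restrict in a *.
  have updE (f : nat -> 'I_n) x : upd (f \o s) k x = upd f k x \o s.
    by rewrite -(upd_inj f k x s_inj) skk.
  rewrite !updE; apply: atpEq_comp a => z; rewrite !ltnS leq_eqVlt => /orP[/eqP ->|/sk].
    by rewrite skk.
  exact: leqW.
rewrite !repl_restrict -(upd_inj nu i u s_inj) -(upd_inj mu i u' s_inj).
  apply: IH.
by have := r (Ordinal (sk _ (ltn_ord i))); rewrite !repl_restrict.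
Qed.

(* Indistinguishability of (k+1)-tuples by stable k-WL: equal atomic types, and
   equal stable colours for each ordered k-subtuple. *)
Definition wl_sim nu mu : Prop :=
  atpEq G H (restrict k.+1 nu) (restrict k.+1 mu) /\
  forall s, injective s -> (forall z, z < k.+1 -> s z < k.+1) ->
  forall t, wlEq G H t (restrict k (nu \o s)) (restrict k (mu \o s)).

Lemma wl_sim_comp s nu mu : injective s -> (forall z, z < k.+1 -> s z < k.+1) ->
  wl_sim nu mu -> wl_sim (nu \o s) (mu \o s).
Proof.
move=> s_inj sk [a W]; split; first exact: atpEq_comp a.
move=> r r_inj rk; apply: (W (s \o r)); first exact: inj_comp.
by move=> z zk; apply/sk/rk.
Qed.

(** Round [T.+1] provides a bijection whose replaced tuples agree at round [T], hence at every
    round. Up to order, any [k] entries of the extended tuple form either the old tuple or one of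
    these replacements. *)
Lemma wl_sim_extend nu mu :
  (forall t, wlEq G H t (restrict k nu) (restrict k mu)) ->
  mset_eq predT predT (fun u u' => wl_sim (upd nu k u) (upd mu k u')).
Proof.
move=> W; have [T stable] := wlEq_stable.
have [_ m] := W T.+1; apply: mset_eq_impl m => u u' _ _ [a r].
split=> [|s s_inj sk t]; first by rewrite -!ext_restrict.
have swap_inj := inv_inj (swapK (s k) k).
(* The swap of [s k] and [k] selects which entry is omitted; the remaining factor fixes [k] and only
   permutes the first [k] entries. *)
have sE (f : nat -> 'I_n) : f \o s = (f \o swap (s k) k) \o (swap (s k) k \o s).
  by apply/funext => z /=; rewrite swapK.
rewrite (sE (upd nu k u)) (sE (upd mu k u')).
have sw_k : (swap (s k) k \o s) k = k by rewrite /= /swap eqxx.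
apply: wlEq_perm => //; first exact: inj_comp.
  move=> z zk; have : swap (s k) k (s z) < k.+1 by apply: swap_lt; rewrite ?sk // leqW.
  rewrite ltnS leq_eqVlt => /orP[/eqP zE|//].
  have /s_inj zk' : s z = s k by apply: swap_inj; rewrite zE [RHS]sw_k.
  by rewrite zk' ltnn in zk.
have := sk k (leqnn _); rewrite ltnS leq_eqVlt => /orP[/eqP skk|lt_sk].
  have fixk f x : restrict k (upd f k x \o swap (s k) k) = restrict k f.
    apply: eq_restrict => z zk.
    by rewrite /= skk /swap (ltn_eqF zk) /upd (ltn_eqF zk).
  by rewrite !fixk.
rewrite !restrict_swap //.
have := stable _ _ (r (Ordinal lt_sk)) t.
by rewrite !repl_restrict.
Qed.

Lemma wl_sim_upd x nu mu : x < k.+1 -> wl_sim nu mu ->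
  mset_eq predT predT (fun u u' => wl_sim (upd nu x u) (upd mu x u')).
Proof.
move=> xk [_ W]; have swap_inj := inv_inj (swapK x k).
have sk z : z < k.+1 -> swap x k z < k.+1 by apply: swap_lt.
apply: mset_eq_impl (wl_sim_extend (W _ swap_inj sk)) => u u' _ _.
rewrite -(upd_inj nu k u swap_inj) -(upd_inj mu k u' swap_inj) swapr.
move=> /(wl_sim_comp swap_inj sk).
have sE (f : nat -> 'I_n) : (f \o swap x k) \o swap x k = f.
  by apply/funext => z /=; rewrite swapK.
by rewrite !sE.
Qed.

Lemma wl_sim_eval nu mu e : varsBelow k.+1 e -> wl_sim nu mu ->
  eval G nu e = eval H mu e.
Proof.
elim: e nu mu => [x y|x y|x y|s x|a IHa b IHb|a IHa b IHb|c a IHa|p f args IH|x a IHa]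
    nu mu /=.
- by move=> [xk yk] [/atpEq_restrict [E _] _]; have [-> _] := E x y xk yk.
- by move=> [xk yk] [/atpEq_restrict [E _] _]; have [-> _] := E x y xk yk.
- by move=> [xk yk] [/atpEq_restrict [E _] _]; have [_ ->] := E x y xk yk.
- by move=> xk [/atpEq_restrict [_ C] _]; rewrite C.
- by move=> [ak bk] sim; rewrite (IHa nu mu) ?(IHb nu mu).
- by move=> [ak bk] sim; rewrite (IHa nu mu) ?(IHb nu mu).
- by move=> ak sim; rewrite (IHa nu mu).
- by move=> argsk sim; congr f; apply/funext => i; apply: IH.
- move=> [xk ak] sim; apply: mset_eq_sum (wl_sim_upd xk sim) _ => u u'.
  exact: IHa.
Qed.

Lemma gwl_rho0_TL (Omega : forall p, (('I_p -> R) -> R) -> Prop) :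
  0 < n -> gwlEq_inf G H k -> rho0_TL Omega k.+1 G H.
Proof.
move=> n0 GH e _ ek e_closed nu; have [T stable] := wlEq_stable.
have [f [f' [fP _]]] := GH T.
have [_ _ /stable W] := fP (restrict k nu) isT.
have {}W t : wlEq G H t (restrict k nu)
    (restrict k (override nu (f (restrict k nu)))).
  by rewrite restrict_override.
(* A similarity involves one more entry than the matched tuples; any vertex, here [Ordinal n0], and
   its partner supply it. *)
have [g [g' [gP _]]] := wl_sim_extend W.
have [_ _ /(wl_sim_eval ek)] := gP (Ordinal n0) isT.
have closedE X mu mu' : eval X mu e = eval X mu' e.
  by apply: eval_ext => z /e_closed.
by rewrite (closedE _ _ nu) (closedE H _ nu).
Qed.

End WLToExpressions.

(** * Colour refinement, two variables and 1-WL *)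

Section ColorRefinement.
Variables (l n : nat).
Implicit Types (e : expr l) (G H K : graph n l) (nu mu : nat -> 'I_n).

Lemma crEq_refl t G v : crEq G G t v v.
Proof.
elim: t v => [|t IH] v //=; split=> //.
by exists id, id; split=> // x Ax; split.
Qed.

Lemma crEq_sym t G H v w : crEq G H t v w -> crEq H G t w v.
Proof.
elim: t v w => [|t IH] v w //= [/IH vw m]; split=> //.
by apply: mset_eq_impl (mset_eq_sym m) => i j _ _ /IH.
Qed.

Lemma crEq_trans t G H K v w x :
  crEq G H t v w -> crEq H K t w x -> crEq G K t v x.
Proof.
elim: t v w x => [|t IH] v w x /=; first by move=> ->.
move=> [vw [f [g [fP gP]]]] [wx [f' [g' [fP' gP']]]]; split; first exact: IH wx.
exists (f' \o f), (g \o g'); split=> [y Ay|y By] /=.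
  have [By gf Ry] := fP y Ay; have [Cy gf' Ry'] := fP' _ By.
  by rewrite gf' gf; split=> //; apply: IH Ry'.
have [Cy fg'] := gP' y By; have [Ay fg] := gP _ Cy.
by rewrite fg fg'.
Qed.

Lemma crEq_le t t' G H v w : t' <= t -> crEq G H t v w -> crEq G H t' v w.
Proof.
elim: t => [|t IH]; first by rewrite leqn0 => /eqP ->.
by rewrite leq_eqVlt => /orP[/eqP ->|] // tt [/(IH tt)].
Qed.

(* The global colour multiset extends the match of the two neighbourhoods to
   the non-neighbours. *)
Lemma crEq_extend t G H v w : gcrEq G H t -> crEq G H t.+1 v w ->
  mset_eq predT predT (fun u u' =>
    [/\ crEq G H t u u', (u == v) = (u' == w) & gE G v u = gE H w u']).
Proof.
move=> GH [vw Nvw].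
pose cN (X : graph n l) (x : 'I_n) : pred 'I_n := predU (pred1 x) (gE X x).
have dis (X : graph n l) (x i : 'I_n) : pred1 x i -> ~~ gE X x i by move=> /eqP ->; rewrite gE_irr.
have one : mset_eq (pred1 v) (pred1 w) (crEq G H t).
  by exists (fun=> w), (fun=> v); split=> x /eqP -> /=; split; rewrite ?eqxx.
(* The global bijection may not respect closed neighbourhoods, so the rest is matched by subtracting
   class sizes. *)
have out : mset_eq (predC (cN G v)) (predC (cN H w)) (crEq G H t).
  apply: (mset_eqC (T := (graph n l * 'I_n)%type) (p := pair G) (q := pair H)
    (E := fun a b => crEq a.1 b.1 t a.2 b.2)) GH => //.
  - by move=> x; apply: crEq_refl.
  - by move=> x y; apply: crEq_sym.
  - by move=> x y z; apply: crEq_trans.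
  - by apply: mset_eqU one Nvw; apply: dis.
(* On each of the three blocks (the vertex, its neighbours, the rest), equality with the vertex and
   adjacency to it are constant. *)
pose R' u u' := [/\ crEq G H t u u', (u == v) = (u' == w) & gE G v u = gE H w u'].
have one' : mset_eq (pred1 v) (pred1 w) R'.
  by apply: mset_eq_impl one => i j /eqP -> /eqP -> r; split; rewrite ?eqxx ?gE_irr.
have Nvw' : mset_eq (gE G v) (gE H w) R'.
  apply: mset_eq_impl Nvw => i j Ni Nj r; split=> //; last by rewrite Ni Nj.
  have neq (X : graph n l) x y : gE X x y -> y == x = false :> bool.
    by apply: contraTF => /eqP ->; rewrite (gE_irr X).
  by rewrite (neq _ _ _ Ni) (neq _ _ _ Nj).
have out' : mset_eq (predC (cN G v)) (predC (cN H w)) R'.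
  apply: mset_eq_impl out => i j.
  move=> /norP[/negPf vi /negPf Ni] /norP[/negPf wj /negPf Nj] r.
  by split; rewrite ?Ni ?Nj // -[LHS]/(pred1 v i) vi -[RHS]/(pred1 w j) wj.
have all' := mset_eqU (dis G v) (dis H w) one' Nvw'.
have disC (A : pred 'I_n) i : A i -> ~~ predC A i by move=> /= ->.
have [f [g [fP gP]]] := mset_eqU (disC _) (disC _) all' out'.
exists f, g; split=> x _.
  by have [] := fP x; rewrite //= orbN.
by have [] := gP x; rewrite //= orbN.
Qed.

(** Each sum uses up one round of the colours at the two variables, while [s <= t] keeps the global
    multiset available for matching non-neighbours. *)
Lemma crEq_eval t s G H nu mu e : gcrEq G H t -> varsBelow 2 e -> sd e <= s -> s <= t ->
  (nu 0 == nu 1) = (mu 0 == mu 1) -> gE G (nu 0) (nu 1) = gE H (mu 0) (mu 1) ->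
  crEq G H s (nu 0) (mu 0) -> crEq G H s (nu 1) (mu 1) ->
  eval G nu e = eval H mu e.
Proof.
move=> GH; elim: e s nu mu =>
  [x y|x y|x y|i x|a IHa b IHb|a IHa b IHb|c a IHa|p f args IH|x a IHa] s nu mu /=.
- move=> [] + + _ _ eq01 _ _ _.
  by case: x y => [|[|x]] [|[|y]] //= _ _; rewrite ?eqxx ?eq01 // eq_sym eq01 eq_sym.
- move=> [] + + _ _ eq01 _ _ _.
  by case: x y => [|[|x]] [|[|y]] //= _ _; rewrite ?eqxx ?eq01 // eq_sym eq01 eq_sym.
- move=> [] + + _ _ _ E01 _ _.
  by case: x y => [|[|x]] [|[|y]] //= _ _; rewrite ?gE_irr ?E01 // gE_sym E01 gE_sym.
- move=> + _ _ _ _ /(crEq_le (leq0n s)) /= c0 /(crEq_le (leq0n s)) /= c1.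
  by case: x => [|[|x]] //= _; rewrite ?c0 ?c1.
- rewrite geq_max => -[a2 b2] /andP[sa sb] st eq01 E01 c0 c1.
  by rewrite (IHa s nu mu) ?(IHb s nu mu).
- rewrite geq_max => -[a2 b2] /andP[sa sb] st eq01 E01 c0 c1.
  by rewrite (IHa s nu mu) ?(IHb s nu mu).
- by move=> a2 sa st eq01 E01 c0 c1; rewrite (IHa s nu mu).
- move=> args2 /bigmax_leqP sargs st eq01 E01 c0 c1.
  by congr f; apply/funext => i; apply: (IH i s) => //; apply: sargs.
- case: s => // s [x2 a2] sa st eq01 E01 c0 c1.
  have GHs : gcrEq G H s by apply: mset_eq_impl GH => i j _ _; apply/crEq_le/ltnW.
  have st' := ltnW st.
  (* Rebinding variable 0 forgets its value, so the bijection is built around variable 1, and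
     conversely. *)
  case: x x2 => [|[|x]] // _.
    apply: mset_eq_sum (crEq_extend GHs c1) _ => u u' [cu equ Eu].
    apply: (IHa s) => //=; first by rewrite /upd /= gE_sym Eu gE_sym.
    by case: c1.
  apply: mset_eq_sum (crEq_extend GHs c0) _ => u u' [cu equ Eu].
  apply: (IHa s) => //=; first by rewrite /upd /= eq_sym equ eq_sym.
  by case: c0.
Qed.

Lemma gcr_rho0_TLt (Omega : forall p, (('I_p -> R) -> R) -> Prop) t G H :
  gcrEq G H t -> rho0_TLt Omega 2 t.+1 G H.
Proof.
move=> GH e _ + + + nu.
elim: e => [x y|x y|x y|s x|a IHa b IHb|a IHa b IHb|c a IHa|p f args IH|x a IHa] /=.
- by move=> _ _ /(_ x) []; left.
- by move=> _ _ /(_ x) []; left.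
- by move=> _ _ /(_ x) []; left.
- by move=> _ _ /(_ x) [].
- rewrite geq_max => -[a2 b2] /andP[sa sb] F.
  by rewrite IHa ?IHb // => z zF; apply: (F z); [right|left].
- rewrite geq_max => -[a2 b2] /andP[sa sb] F.
  by rewrite IHa ?IHb // => z zF; apply: (F z); [right|left].
- by move=> a2 sa F; rewrite IHa.
- move=> args2 /bigmax_leqP sargs F; congr f; apply/funext => i; apply: IH => //.
    exact: sargs.
  by move=> z zF; apply: (F z); exists i.
- move=> [x2 a2] sa F; apply: mset_eq_sum (GH) _ => u u' uu'.
  (* At most [x] is free in [a], so both variables may take the same value; their equality and
     adjacency then match trivially. *)
  have constE X w : eval X (upd nu x w) a = eval X (fun=> w) a.
    apply: eval_ext => z zF; rewrite /upd; case: eqP => // zx.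
    by case: (F z).
  rewrite !constE; apply: (@crEq_eval t t G H) => //.
  + by rewrite !eqxx.
  + by rewrite !gE_irr.
Qed.

(** The type of the pair [(v, u)] records adjacency, so the bijection between all vertices restricts
    to the neighbourhoods. *)
Lemma wl1_crEq t G H nu mu :
  wlEq G H t (restrict 1 nu) (restrict 1 mu) -> crEq G H t (nu 0) (mu 0).
Proof.
elim: t nu mu => [|t IH] nu mu /=.
  by move=> /atpEq_restrict [_ C]; apply: C.
move=> [/IH vw [f [g [fP gP]]]]; split=> //.
have RE u u' : atpEq G H (ext (restrict 1 nu) u) (ext (restrict 1 mu) u') ->
    gE G (nu 0) u = gE H (mu 0) u'.
  by rewrite !ext_restrict => /atpEq_restrict [E _]; have [] := E 0 1 isT isT.
exists f, g; split=> [u Nu|u' Nu'].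
  have [_ gf [a r]] := fP u isT; split=> //; first by rewrite -(RE _ _ a).
  by have := r ord0; rewrite !repl_restrict => /IH.
have [_ fg] := gP u' isT; split=> //; have [_ _ [a _]] := fP (g u') isT.
by rewrite (RE _ _ a) fg.
Qed.

Lemma gwl1_gcr t G H : gwlEq G H 1 t -> gcrEq G H t.
Proof.
move=> [f [g [fP gP]]].
have restrictE (v : {ffun 'I_1 -> 'I_n}) : restrict 1 (fun=> v ord0) = v.
  by apply/ffunP => i; rewrite ffunE (ord1 i).
have e0 (u : 'I_n) : restrict 1 (fun=> u) ord0 = u by rewrite ffunE.
exists (fun u => f (restrict 1 (fun=> u)) ord0).
exists (fun u => g (restrict 1 (fun=> u)) ord0).
split=> [u _|u _].
  have [_ gf W] := fP (restrict 1 (fun=> u)) isT.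
  rewrite restrictE gf e0; split=> //.
  by rewrite -[f _]restrictE in W; apply: (wl1_crEq W).
have [_ fg] := gP (restrict 1 (fun=> u)) isT.
by rewrite restrictE fg e0.
Qed.

End ColorRefinement.

Theorem theorem4 (n l : nat) (Hn : 0 < n) (Hl : 0 < l)
  (Omega : forall p : nat, (('I_p -> R) -> R) -> Prop)
  (HOmega : forall p f, Omega p f -> 0 < p)
  (t k : nat) (Hk : 0 < k) :
  (forall G H : graph n l,
     (gcrEq G H t <-> rho0_TLt Omega 2 t.+1 G H) /\
     (rho0_TLt Omega 2 t.+1 G H <-> gwlEq G H 1 t)) /\
  (forall G H : graph n l,
     gwlEq_inf G H k <-> rho0_TL Omega k.+1 G H).
Proof.
split=> G H.
  (* Part (1) follows from a cycle of implications: expressions to 1-WL, 1-WL to colour refinement,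
     and back to expressions. For [k = 1] the depth [k + t] is [t.+1]. *)
  have TL_wl : rho0_TLt Omega 2 t.+1 G H -> gwlEq G H 1 t.
    exact: (@rho0_TLt_gwl l n Omega 1 t).
  split; split=> //; first exact: gcr_rho0_TLt.
    by move=> /TL_wl /gwl1_gcr.
  by move=> /gwl1_gcr; apply: gcr_rho0_TLt.
split=> [|GH s]; first exact: gwl_rho0_TL.
by apply: (@rho0_TLt_gwl _ _ Omega) => // e eO ek _; apply: GH.
Qed.
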